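(* Let $\Gamma,\Sigma$ be finite abelian groups, $\Sigma^*=\mathrm{Hom}(\Sigma,\mathbb{C}^\times)$, and let $$1\to\Sigma^*\to G\xrightarrow{\ \pi\ }\Gamma\to 1$$ be a central extension ($\Sigma^*\subset Z(G)$). Fix a set-theoretic section $s:\Gamma\to G$ of $\pi$ with $s(1)=1$, and let $\sigma\in Z^2(\Gamma,\Sigma^* )$ be the 2-cocycle with $s(\bar g)s(\bar h)=\sigma(\bar g,\bar h)s(\bar g\bar h)$. Let $M$ be an indecomposable Yetter-Drinfel'd module over $\Gamma$ with an action $(f_p)_{p\in\Sigma}$ of $\Sigma$ on $M$ as twisted symmetries with respect to $\sigma$. Because $\Sigma$ is abelian, the action can be simultaneously diagonalized; decompose $M$ into the simultaneous eigenspaces $M^{[\lambda]}=\{v\in M\mid f_p(v)=\lambda(p)v\ \ \forall p\in\Sigma\}$, $\lambda\in\Sigma^*$, and write $M^{[\lambda]}_{\bar h}=M^{[\lambda]}\cap M_{\bar h}$. Then the following structures define a Yetter-Drinfel'd module $\tilde M$ over $G$ (called the covering Yetter-Drinfel'd module of $M$): (i) $\tilde M:=M$ as a vector space; (ii) the $G$-action on $\tilde M$ is the pullback of the $\Gamma$-action on $M$ via $\pi$; in particular $\Sigma^*\subset G$ acts trivially and thus $\tilde M$ is not faithful; (iii) the eigenspaces give rise to the $G$-homogeneous components via, with $\bar h=\pi(h)$, $$\tilde M_h:=M_{\bar h}^{[h\,s(\bar h)^{-1}]}\qquad (h\in G),$$ where $\pi(h\,s(\bar h)^{-1})=1$, so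 that $h\,s(\bar h)^{-1}$ is indeed an element of $\ker\pi=\Sigma^*$.
   Context: All groups are finite; vector spaces are finite-dimensional over $\mathbb{C}$. A Yetter-Drinfel'd module over a group $\Gamma$ is a $\Gamma$-graded vector space $M=\bigoplus_{g\in\Gamma}M_g$ with a $\Gamma$-action such that $g.M_h=M_{ghg^{-1}}$. Its braiding $c=c_{MM}:M\otimes M\to M\otimes M$ is $c(v\otimes w)=g.w\otimes v$ for $v\in M_g$. $M$ is indecomposable if $\{g\mid M_g\ne0\}$ generates $\Gamma$; it is faithful if the action is faithful. If $\Gamma$ is abelian, $M=\bigoplus_{i\in I}M_i$ with $M_i=x_i\mathbb{C}$ one-dimensional, of degree $\bar g_i\in\Gamma$ and with action by a character $\chi_i$. A linear bijection $f:M\to M$ is a twisted symmetry if it preserves the $\Gamma$-grading, satisfies $(f\otimes f)c=c(f\otimes f)$ on each $M_i\otimes M_i$ (preserves self-braiding), and $(f\otimes f)c^2=c^2(f\otimes f)$ on each $M_i\otimes M_j$ (preserves monodromy). For indecomposable $M$, $f$ is a twisted symmetry with respect to a bimultiplicative form $\langle\cdot,\cdot\rangle:\Gamma\times\Gamma\to\mathbb{C}^\times$ if it is a twisted symmetry and moreover $c(f\otimes f)=\langle\bar g_i,\bar g_j\rangle\,(f\otimes f)c$ on $M_i\otimes M_j$ for all $i,j$. $\Sigma$ acts on $M$ as twisted symmetries with respect to $\sigma\in Z^2(\Gamma,\Sigma^* )$ if there are linear bijections $f_p:M\to M$ ($p\in\Sigma$) with $f_1=\mathrm{id}$, $f_pf_q=f_{pq}$,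 such that each $f_p$ is a twisted symmetry with respect to the form $\langle\bar g,\bar h\rangle_p=\sigma(\bar g,\bar h)(p)\,\sigma(\bar h,\bar g)(p)^{-1}$.
   Formalization: The twisted-symmetry relation is taken as (f⊗f)c = ⟨g_i,g_j⟩ c(f⊗f), i.e. with the form inverted relative to the usual reading, under which the claim fails (e.g. Σ=Z_3, Γ=Z_3²); and non-faithfulness of M̃ is asserted only for Σ ≠ 1, since for Σ = 1 one has M̃ = M. *)

(* Defs.v *)
From HB Require Import structures.
From mathcomp Require Import all_boot all_order all_algebra all_fingroup.
From mathcomp Require Import center complex.
From mathcomp Require Import classical_sets reals.
Import passmx.

Set Implicit Arguments.
Unset Strict Implicit.
Unset Printing Implicit Defensive.

Import GRing.Theory.
Local Open Scope ring_scope.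

(* [dual A F] is the group Hom(A, F^x) under pointwise multiplication. *)
Section Dual.
Variables (A : finGroupType) (F : fieldType).

Definition is_char (chi : {ffun A -> F}) : bool :=
  [forall a, chi a != 0] && [forall a, forall b, chi (a * b)%g == chi a * chi b].

Record dual := Dual { dual_fun :> {ffun A -> F}; _ : is_char dual_fun }.

HB.instance Definition _ := [isSub for dual_fun].
HB.instance Definition _ := [Choice of dual by <:].

Lemma dual_neq0 (chi : dual) a : chi a != 0.
Proof. by case: chi => f /= /andP[/forallP]. Qed.

Lemma dualM (chi : dual) a b : chi (a * b)%g = chi a * chi b.
Proof.
by case: chi => f /= /andP[_ /forallP/(_ a)/forallP/(_ b)/eqP].
Qed.

Fact dual_one_subproof : is_char [ffun=> 1].
Proof.
apply/andP; split; apply/forallP => a; first by rewrite ffunE oner_neq0.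
by apply/forallP => b; rewrite !ffunE mulr1.
Qed.

Fact dual_mul_subproof (chi psi : dual) : is_char [ffun a => chi a * psi a].
Proof.
apply/andP; split; apply/forallP => a.
  by rewrite ffunE mulf_neq0 ?dual_neq0.
by apply/forallP => b; rewrite !ffunE !dualM mulrACA.
Qed.

Fact dual_inv_subproof (chi : dual) : is_char [ffun a => (chi a)^-1].
Proof.
apply/andP; split; apply/forallP => a.
  by rewrite ffunE invr_neq0 ?dual_neq0.
by apply/forallP => b; rewrite !ffunE dualM invfM.
Qed.

Definition dual_one : dual := Dual dual_one_subproof.
Definition dual_mul (chi psi : dual) : dual := Dual (dual_mul_subproof chi psi).
Definition dual_inv (chi : dual) : dual := Dual (dual_inv_subproof chi).

Fact dual_mulA : associative dual_mul.
Proof. by move=> f g h; apply/val_inj/ffunP => a /=; rewrite !ffunE mulrA. Qed.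

Fact dual_mul1 : left_id dual_one dual_mul.
Proof. by move=> f; apply/val_inj/ffunP => a /=; rewrite !ffunE mul1r. Qed.

Fact dual_mulr1 : right_id dual_one dual_mul.
Proof. by move=> f; apply/val_inj/ffunP => a /=; rewrite !ffunE mulr1. Qed.

Fact dual_mulV : left_inverse dual_one dual_inv dual_mul.
Proof.
by move=> f; apply/val_inj/ffunP => a /=; rewrite !ffunE mulVf ?dual_neq0.
Qed.

Fact dual_mulrV : right_inverse dual_one dual_inv dual_mul.
Proof.
by move=> f; apply/val_inj/ffunP => a /=; rewrite !ffunE mulfV ?dual_neq0.
Qed.

HB.instance Definition _ := isGroup.Build dual
  dual_mulA dual_mul1 dual_mulr1 dual_mulV dual_mulrV.

Lemma dual1E a : (1%g : dual) a = 1.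
Proof. by rewrite /= ffunE. Qed.

Lemma dualME (chi psi : dual) a : (chi * psi)%g a = chi a * psi a.
Proof. by rewrite /= ffunE. Qed.

Lemma dualVE (chi : dual) a : (chi^-1)%g a = (chi a)^-1.
Proof. by rewrite /= ffunE. Qed.

End Dual.

(* [tens V] realises [V (x) V] by matrices of coordinates in the basis
   [vbasis {:V}] of [V]: [v (x) w] is the matrix of entries [v_i * w_j]. *)

Notation tens V := 'M_(\dim {:V}, \dim {:V}).

Section Tensor.
Variables (F : fieldType) (V : vectType F).
Local Notation e := (vbasis {:V}).

Definition tmul (v w : V) : tens V := (rVof e v)^T *m rVof e w.

Definition tmap_fun (f g : 'End(V)) (t : tens V) : tens V :=
  (mxof e e f)^T *m t *m mxof e e g.

Fact tmap_is_linear f g : linear (tmap_fun f g).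
Proof. by move=> a t u; rewrite /tmap_fun mulmxDr mulmxDl -scalemxAr -scalemxAl. Qed.

HB.instance Definition _ f g := GRing.isLinear.Build F (tens V) (tens V) _
  (tmap_fun f g) (tmap_is_linear f g).

Definition tmap (f g : 'End(V)) : 'End(tens V) := linfun (tmap_fun f g).

Definition tflip : 'End(tens V) := linfun (@trmx F _ _).

Lemma tmul_basis (i j : 'I_(\dim {:V})) : tmul e`_i e`_j = delta_mx i j.
Proof.
by rewrite /tmul !rVofE ?vbasisP // trmx_delta mul_delta_mx.
Qed.

Lemma tmapE f g v w : tmap f g (tmul v w) = tmul (f v) (g w).
Proof.
rewrite lfunE /= /tmap_fun /tmul !(rVof_app e (vbasisP _)).
by rewrite trmx_mul !mulmxA.
Qed.

Lemma tflipE v w : tflip (tmul v w) = tmul w v.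
Proof. by rewrite lfunE /= /tmul trmx_mul trmxK. Qed.

End Tensor.

Section YetterDrinfeld.
Variables (F : fieldType) (Gam : finGroupType) (V : vectType F).
Implicit Types (comp : Gam -> {vspace V}) (act : Gam -> 'End(V)).

Definition is_action (A : finGroupType) (rho : A -> 'End(V)) : Prop :=
  rho 1%g = \1%VF /\ forall a b, rho (a * b)%g = (rho a \o rho b)%VF.

Definition is_grading comp : Prop :=
  directv (\sum_g comp g)%VS /\ (\sum_g comp g)%VS = fullv.

Record is_yetter_drinfeld comp act : Prop := {
  yd_action : is_action act;
  yd_grading : is_grading comp;
  yd_compat : forall g h, (act g @: comp h)%VS = comp (g * h * g^-1)%g
}.

Definition indecomposable comp : Prop :=
  <<[set g | comp g != 0%VS]>>%g = [set: Gam].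

Definition faithful_action act : Prop := forall g, act g = \1%VF -> g = 1%g.

Definition grade_proj comp (g : Gam) : 'End(V) :=
  sumv_pi (\sum_h comp h)%VS g.

Definition braiding comp act : 'End(tens V) :=
  (\sum_g (tflip V \o tmap (grade_proj comp g) (act g)))%VF.

Lemma grade_projE comp g h v : is_grading comp -> v \in comp h ->
  grade_proj comp g v = if g == h then v else 0.
Proof.
move=> [dir full] vh.
pose w k := if k == h then v else 0.
have wP k : true -> w k \in comp k.
  by rewrite /w; case: eqP => [->|_]; rewrite ?mem0v.
have pP k : true -> grade_proj comp k v \in comp k by rewrite memv_sum_pi.
have/directv_sum_unique/(_ _ _ pP wP) := dir.
have -> : \sum_i grade_proj comp i v = v by rewrite sumv_pi_sum // full memvf.
rewrite -big_mkcond big_pred1_eq eqxx => /esym/forall_inP/(_ g isT)/eqP.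
by rewrite /w.
Qed.

Lemma braidingE comp act g v w : is_grading comp -> v \in comp g ->
  braiding comp act (tmul v w) = tmul (act g w) v.
Proof.
move=> grd vg; rewrite sum_lfunE (bigD1 g) //= big1 => [|h /negPf hg].
  by rewrite comp_lfunE tmapE tflipE (grade_projE _ grd vg) eqxx addr0.
rewrite comp_lfunE tmapE tflipE (grade_projE _ grd vg) hg.
by rewrite /tmul linear0 mulmx0.
Qed.

Record diagonal_decomposition comp act (I : finType) (x : I -> V)
    (gb : I -> Gam) (chi : I -> dual Gam F) : Prop := {
  decomp_basis : basis_of fullv (codom x);
  decomp_degree : forall i, x i \in comp (gb i);
  decomp_act : forall i g, act g (x i) = chi i g *: x i
}.

Record bimultiplicative (form : Gam -> Gam -> F) : Prop := {
  form_neq0 : forall g h, form g h != 0;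
  formMl : forall g g' h, form (g * g')%g h = form g h * form g' h;
  formMr : forall g h h', form g (h * h')%g = form g h * form g h'
}.

(* Each [M_i = <[x i]>] is a line, so an identity of linear maps on
   [M_i (x) M_j] is its instance at [tmul (x i) (x j)]. *)
Record twisted_symmetry comp act (I : finType) (x : I -> V) (f : 'End(V)) :
    Prop := {
  ts_bij : bijective f;
  ts_grading : forall g, (f @: comp g <= comp g)%VS;
  ts_self_braiding : forall i, let t := tmul (x i) (x i) in
    let c := braiding comp act in
    tmap f f (c t) = c (tmap f f t);
  ts_monodromy : forall i j, let t := tmul (x i) (x j) in
    let c := braiding comp act in
    tmap f f (c (c t)) = c (c (tmap f f t))
}.

(* Composites of operators in the defining relation
     c (f (x) f) = <g_i, g_j> (f (x) f) c
   are read from left to right: the left-hand side applies [c] first. With the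
   opposite order [form] would be replaced by its inverse, and, unless [form]
   only takes the values 1 and -1, [covering_comp] below would satisfy
   [g.M_h = M_(g^-1 h g)] instead of [g.M_h = M_(g h g^-1)]. *)
Record twisted_symmetry_wrt comp act (I : finType) (x : I -> V) (gb : I -> Gam)
    (form : Gam -> Gam -> F) (f : 'End(V)) : Prop := {
  tsw_form : bimultiplicative form;
  tsw_sym : twisted_symmetry comp act x f;
  tsw_braiding : forall i j, let t := tmul (x i) (x j) in
    let c := braiding comp act in
    tmap f f (c t) = form (gb i) (gb j) *: c (tmap f f t)
}.

End YetterDrinfeld.

Section Extension.
Variables (F : fieldType) (Gam Sig G : finGroupType).

Record central_extension (iota : {multiplicative dual Sig F -> G})
    (pi : {morphism [set: G] >-> Gam}) : Prop := {
  ext_inj : injective iota;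
  ext_exact : forall k, k \in ('ker pi)%g <-> exists lam, iota lam = k;
  ext_surj : (pi @* [set: G])%g = [set: Gam];
  ext_central : forall lam, iota lam \in ('Z([set: G]))%g
}.

Record normalized_section (pi : G -> Gam) (s : Gam -> G) : Prop := {
  section_cancel : cancel s pi;
  section1 : s 1%g = 1%g
}.

Definition cocycle2 (sig : Gam -> Gam -> dual Sig F) : Prop :=
  forall g h k, (sig g h * sig (g * h) k = sig h k * sig g (h * k))%g.

Definition sig_form (sig : Gam -> Gam -> dual Sig F) (p : Sig) (g h : Gam) : F :=
  sig g h p * (sig h g p)^-1.

(* [iota^-1 k] if [k] is in the image of [iota], that is in the kernel of the
   extension; the trivial character otherwise. *)
Definition ker_dual (iota : dual Sig F -> G) (k : G) : dual Sig F :=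
  xget 1%g [set lam | iota lam = k]%classic.

End Extension.

Section Covering.
Variables (F : fieldType) (Gam Sig G : finGroupType) (V : vectType F).
Variables (comp : Gam -> {vspace V}) (act : Gam -> 'End(V)).

Record acts_as_twisted_symmetries (I : finType) (x : I -> V) (gb : I -> Gam)
    (sig : Gam -> Gam -> dual Sig F) (f : Sig -> 'End(V)) : Prop := {
  ats_action : is_action f;
  ats_twisted : forall p, twisted_symmetry_wrt comp act x gb (sig_form sig p) (f p)
}.

Definition eigen (f : Sig -> 'End(V)) (lam : dual Sig F) : {vspace V} :=
  (\bigcap_p lker (f p - lam p *: \1%VF))%VS.

Lemma eigenP (f : Sig -> 'End(V)) (lam : dual Sig F) v :
  reflect (forall p, f p v = lam p *: v) (v \in eigen f lam).
Proof.
rewrite memvE; apply: (iffP subv_bigcapP) => vE p; last move=> _.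
  have := vE p isT; rewrite -memvE memv_ker !lfun_simp => /eqP.
  by move/eqP; rewrite subr_eq0 => /eqP.
by rewrite -memvE memv_ker !lfun_simp vE subrr.
Qed.

Definition covering_act (pi : G -> Gam) (g : G) : 'End(V) := act (pi g).

Definition covering_comp (iota : dual Sig F -> G) (pi : G -> Gam)
    (s : Gam -> G) (f : Sig -> 'End(V)) (h : G) : {vspace V} :=
  (eigen f (ker_dual iota (h * (s (pi h))^-1)%g) :&: comp (pi h))%VS.

End Covering.

(* Main.v *)
(* Write [h = iota lam * s k], so that the component of degree [h] of the
   covering is the [lam]-eigenspace of [Sigma] in [M_k]. Each [f_p] has finite
   order and preserves [M_k], and the [f_p] commute; hence [M_k] is the sum of
   its simultaneous eigenspaces, and the sum is direct by orthogonality of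
   characters. On [M_k] the twisted symmetry condition, extended from the
   degrees [gb i] to the group they generate, reads
     [f_p (g v) = sig g k p / sig k g p *: g (f_p v)],
   so [g] multiplies the eigencharacter by [sig g k / sig k g]; this is also
   the commutator of lifts of [g] and [k] to [G], that is the factor by which
   conjugation by [g] changes [h]. Finally [iota] of any nontrivial character
   of [Sigma] acts trivially; such a character exists because otherwise
   diagonalization would make the regular representation trivial. *)
Require Import Defs.
From HB Require Import structures.
From mathcomp Require Import all_boot all_order all_algebra all_fingroup.
From mathcomp Require Import center cyclic separable cyclotomic complex boolp classical_sets.
From mathcomp Require Import reals.
Local Open Scope ring_scope.

Set Implicit Arguments.
Unset Strict Implicit.
Unset Printing Implicit Defensive.
Import passmx GRing.Theory Num.Theory.

Lemma prim_root_exists (F : numClosedFieldType) (n : nat) :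
  (0 < n)%N -> exists z : F, n.-primitive_root z.
Proof.
move=> n_gt0; pose p : {poly F} := 'X^n - 1.
have [r Dp] := closed_field_poly_normal p.
move: Dp; rewrite (monicP _) ?monicXnsubC // scale1r => Dp.
have rn1 : all n.-unity_root r.
  by apply/allP => z; rewrite -root_prod_XsubC -Dp.
have sz_r : (n < (size r).+1)%N.
  by rewrite -(size_prod_XsubC r id) -Dp size_XnsubC.
have [|z] := hasP (has_prim_root n_gt0 rn1 _ sz_r); last by exists z.
by rewrite -separable_prod_XsubC -Dp separable_Xn_sub_1 // pnatr_eq0 -lt0n.
Qed.

Lemma sum_unity_root (F : fieldType) (n : nat) (y : F) :
  y ^+ n = 1 -> y != 1 -> \sum_(k < n) y ^+ k = 0.
Proof.
move=> yn1 y1; have /esym/eqP := subrX1 y n.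
by rewrite yn1 subrr mulf_eq0 subr_eq0 (negPf y1) => /eqP.
Qed.

Lemma sum_ord_shift (V : zmodType) n (u : nat -> V) :
  u n = u 0%N -> \sum_(j < n) u j.+1 = \sum_(j < n) u j.
Proof.
case: n => [|n] un; first by rewrite !big_ord0.
by rewrite big_ord_recr big_ord_recl /= un addrC.
Qed.

Section Action.
Variables (F : fieldType) (A : finGroupType) (V : vectType F).
Variable rho : A -> 'End(V).
Hypothesis rhoP : Defs.is_action rho.

Lemma action1 v : rho 1%g v = v.
Proof. by have [-> _] := rhoP; rewrite id_lfunE. Qed.

Lemma actionM a b v : rho (a * b)%g v = rho a (rho b v).
Proof. by have [_ ->] := rhoP; rewrite comp_lfunE. Qed.

Lemma commute_invariant p q (c : F) (W : {vspace V}) : commute p q ->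
  (rho q @: W <= W)%VS ->
  (rho q @: (W :&: lker (rho p - c *: \1%VF)) <= W :&: lker (rho p - c *: \1%VF))%VS.
Proof.
move=> pq Wq; apply/subvP => _ /memv_imgP[v /memv_capP[Wv vp] ->].
rewrite memv_cap (subvP Wq) ?memv_img //=; move: vp.
rewrite !memv_ker !lfun_simp !subr_eq0 => /eqP vp.
by rewrite -actionM pq actionM vp linearZ.
Qed.

End Action.

Section Eigenspaces.
Variables (F : numClosedFieldType) (A : finGroupType) (V : vectType F).
Variable rho : A -> 'End(V).
Hypothesis rhoP : Defs.is_action rho.

(* Averaging [z ^- (j k) rho (p ^ j)] over [j], for [z] a primitive root of
   unity of order [#[p]], projects onto the [z ^ k]-eigenspace of [rho p]. *)
Lemma cyclic_eigen_sum (p : A) (W : {vspace V}) v :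
    (rho p @: W <= W)%VS -> v \in W ->
  exists n (z : nat -> F) (w : 'I_n -> V),
    v = \sum_k w k /\ forall k : 'I_n, w k \in W /\ rho p (w k) = z k *: w k.
Proof.
move=> Wp Wv; pose n := #[p]%g; have n_gt0 : (0 < n)%N by apply: order_gt0.
have [z zP] := @prim_root_exists F n n_gt0.
have zn : z ^+ n = 1 by apply: prim_expr_order.
have z0 : z != 0 by rewrite (prim_root_eq0 zP) -lt0n.
have n0 : n%:R != 0 :> F by rewrite pnatr_eq0 -lt0n.
pose u k j : V := (z ^- k) ^+ j *: rho (p ^+ j)%g v.
exists n, (GRing.exp z), (fun k => n%:R^-1 *: \sum_(j < n) u k j).
have Wu k j : u k j \in W.
  rewrite memvZ //; elim: j => [|j IHj]; first by rewrite expg0 (action1 rhoP).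
  by rewrite expgS (actionM rhoP) (subvP Wp) // memv_img.
split=> [|k]; last split.
- have u0 (j : 'I_n) : j != Ordinal n_gt0 -> \sum_(k < n) u k j = 0.
    move=> j0; rewrite /u -scaler_suml.
    rewrite (eq_bigr (fun k : 'I_n => (z ^- j) ^+ k)); last first.
      by move=> k _; rewrite !exprVn -!exprM mulnC.
    rewrite sum_unity_root ?scale0r //.
      by rewrite exprVn exprAC zn expr1n invr1.
    rewrite invr_eq1 -(expr0 z) (eq_prim_root_expr zP) mod0n modn_small //.
  rewrite -scaler_sumr exchange_big /= (bigD1 (Ordinal n_gt0)) //=.
  rewrite [X in _ + X]big1 // addr0 (eq_bigr (fun=> v)) => [|k _].
    by rewrite sumr_const card_ord -scaler_nat scalerA mulVf ?scale1r.
  by rewrite /u expr0 scale1r expg0 (action1 rhoP).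
- by rewrite memvZ // rpred_sum.
rewrite linearZ /= !scalerA mulrC -scalerA; congr (_ *: _).
have step j : rho p (u k j) = z ^+ k *: u k j.+1.
  rewrite linearZ /= -(actionM rhoP) -expgS scalerA; congr (_ *: _).
  by rewrite exprSr exprVn mulrCA mulfV ?mulr1 // expf_neq0.
rewrite linear_sum (eq_bigr _ (fun j _ => step (val j))) -scaler_sumr.
congr (_ *: _).
have un : u k n = u k 0%N.
  by rewrite /u expg_order exprVn exprAC zn expr1n invr1 expr0 expg0.
exact: sum_ord_shift.
Qed.

Hypothesis abA : abelian [set: A].

Let comm (p q : A) : commute p q.
Proof. by apply: (centsP abA); rewrite inE. Qed.

Lemma subv_common_eigen (s : seq A) (U W : {vspace V}) :
    (forall q, (rho q @: W <= W)%VS) ->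
    (forall w, w \in W -> (forall p, p \in s -> exists a, rho p w = a *: w) ->
       w \in U) ->
  (W <= U)%VS.
Proof.
elim: s W => [|p s IHs] W Winv WU; apply/subvP => v Wv; first by apply: WU.
have [n [z [w [-> wP]]]] := cyclic_eigen_sum (Winv p) Wv.
apply: rpred_sum => k _; have [Ww wE] := wP k.
pose W' := (W :&: lker (rho p - z k *: \1%VF))%VS.
have W'w : w k \in W' by rewrite memv_cap Ww memv_ker !lfun_simp wE subrr eqxx.
suff W'U : (W' <= U)%VS by apply: (subvP W'U).
apply: IHs => [q|w' /memv_capP[Ww']].
  exact: (commute_invariant rhoP).
rewrite memv_ker !lfun_simp subr_eq0 => /eqP w'E sE; apply: WU => // q.
by rewrite inE => /predU1P[->|/sE //]; exists (z k).
Qed.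

Lemma subv_eigen (U W : {vspace V}) :
    (forall q, (rho q @: W <= W)%VS) ->
    (forall lam : dual A F, (eigen rho lam :&: W <= U)%VS) ->
  (W <= U)%VS.
Proof.
move=> Winv eU; apply: (@subv_common_eigen (enum A)) => // w Ww ew.
have [->|w0] := eqVneq w 0; first exact: mem0v.
have [a aE] : exists a : A -> F, forall p, rho p w = a p *: w.
  apply: (@fin_all_exists A (fun=> F) (fun p a => rho p w = a *: w)) => p.
  by apply: ew; rewrite mem_enum.
have wI : injective (fun c : F => c *: w).
  by move=> c d /eqP; rewrite -subr_eq0 -scalerBl scaler_eq0 (negPf w0) orbF subr_eq0 => /eqP.
have a1 : a 1%g = 1 by apply: wI; rewrite /= -aE (action1 rhoP) scale1r.
have aM p q : a (p * q)%g = a p * a q.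
  by apply: wI; rewrite /= -aE (actionM rhoP) !aE linearZ /= aE scalerA mulrC.
have a_char : is_char (finfun a).
  apply/andP; split; apply/forallP => p; last first.
    by apply/forallP => q; rewrite !ffunE aM.
  apply/eqP; rewrite ffunE => ap0; have /eqP := oner_neq0 F; apply.
  by rewrite -a1 -(mulgV p) aM ap0 mul0r.
apply: (subvP (eU (Dual a_char))); rewrite memv_cap Ww andbT.
by apply/eigenP => p /=; rewrite ffunE.
Qed.

Lemma action_trivial_of_dual : (forall lam : dual A F, lam = 1%g) ->
  forall p, rho p = \1%VF.
Proof.
move=> triv p; apply/lfunP => v; rewrite id_lfunE.
suff /subvP/(_ v (memvf v))/eigenP-> : (fullv <= eigen rho 1%g)%VS.
  by rewrite dual1E scale1r.
apply: subv_eigen => [q|lam]; first exact: subvf.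
by rewrite (triv lam) capvSl.
Qed.

End Eigenspaces.

Section RegularRepresentation.
Variables (F : fieldType) (A : finGroupType).
Local Notation V := {ffun A -> F^o}.

Definition shift_fun (p : A) (v : V) : V := [ffun a => v (a * p)%g].

Fact shift_fun_is_linear p : linear (shift_fun p).
Proof. by move=> c v w; apply/ffunP => a; rewrite !ffunE. Qed.

HB.instance Definition _ p := GRing.isLinear.Build F V V _
  (shift_fun p) (shift_fun_is_linear p).

Lemma shift_action : Defs.is_action (fun p => linfun (shift_fun p)).
Proof.
split=> [|p q]; apply/lfunP => v; rewrite ?comp_lfunE !lfunE /=;
  by apply/ffunP => a; rewrite !ffunE ?mulg1 ?mulgA.
Qed.

End RegularRepresentation.

Lemma nontrivial_dual (F : numClosedFieldType) (A : finGroupType) :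
  abelian [set: A] -> (1 < #|A|)%N -> exists lam : dual A F, lam != 1%g.
Proof.
move=> abA cardA; apply: contrapT => triv.
have {}triv (lam : dual A F) : lam = 1%g.
  by apply/eqP/negPn/negP => lam1; apply: triv; exists lam.
have rho1 := action_trivial_of_dual (@shift_action F A) abA triv.
have p1 (p : A) : p = 1%g.
  pose v : {ffun A -> F^o} := [ffun a => (a == 1%g)%:R].
  have /ffunP/(_ 1%g) : linfun (shift_fun p) v = v by rewrite rho1 id_lfunE.
  rewrite lfunE /= !ffunE mul1g eqxx.
  by case: eqP => // _ /esym/eqP; rewrite oner_eq0.
suff : (#|A| <= 1)%N by rewrite leqNgt cardA.
by apply/fintype_le1P => p q; rewrite (p1 p) (p1 q).
Qed.

Lemma sum_dual (F : fieldType) (A : finGroupType) (lam : dual A F) :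
  lam != 1%g -> \sum_p lam p = 0.
Proof.
move=> lam1; have [p lamp] : exists p, lam p != 1.
  apply/existsP; apply: contraR lam1; rewrite negb_exists => /forallP lam1.
  by apply/eqP/val_inj/ffunP => p; rewrite [RHS]dual1E; apply/eqP/negPn/lam1.
apply/eqP; have : (lam p - 1) * \sum_q lam q == 0.
  rewrite mulrBl mul1r subr_eq0 big_distrr.
  rewrite [eqbRHS](reindex_inj (mulgI p)) /=.
  by apply/eqP/eq_bigr => q _; rewrite dualM.
by rewrite mulf_eq0 subr_eq0 (negPf lamp).
Qed.

Section Braiding.
Variables (F : fieldType) (V : vectType F).

Lemma tmulZl c (v w : V) : tmul (c *: v) w = c *: tmul v w.
Proof. by rewrite /tmul linearZ linearZ /= scalemxAl. Qed.

Lemma tmul_injl (v v' w : V) : w != 0 -> tmul v w = tmul v' w -> v = v'.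
Proof.
move=> w0 vv'; have [k wk] : exists k, rVof (vbasis {:V}) w 0 k != 0.
  apply/existsP; apply: contraR w0; rewrite negb_exists => /forallP w0.
  rewrite -(rVof_eq0 (vbasisP _)); apply/eqP/rowP => k.
  by rewrite [RHS]mxE; apply/eqP/negPn/w0.
apply: (can_inj (rVofK (vbasisP _))); apply/rowP => i.
apply: (mulIf wk); have /matrixP/(_ i k) := vv'.
by rewrite !mxE !big_ord_recl !big_ord0 !addr0 !mxE.
Qed.

Variables (Gam : finGroupType) (comp : Gam -> {vspace V}).
Variable act : Gam -> 'End(V).
Variables (I : finType) (x : I -> V) (gb : I -> Gam) (chi : I -> dual Gam F).
Hypothesis decM : diagonal_decomposition comp act x gb chi.

Lemma basis_vec_neq0 i : x i != 0.
Proof.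
have /andP[_ /free_not0-> //] := decomp_basis decM.
exact: codom_f.
Qed.

Hypothesis grd : is_grading comp.

Lemma subv_graded h (U : {vspace V}) :
  (forall j, gb j = h -> x j \in U) -> (comp h <= U)%VS.
Proof.
move=> xU; apply/subvP => v vh.
have <- : grade_proj comp h v = v by rewrite (grade_projE _ grd vh) eqxx.
have : grade_proj comp h v \in (grade_proj comp h @: <<codom x>>)%VS.
  by rewrite memv_img // (span_basis (decomp_basis decM)) memvf.
rewrite limg_span; apply: subvP; apply/span_subvP => _ /mapP[_ /codomP[j ->] ->].
rewrite (grade_projE _ grd (decomp_degree decM j)).
by case: eqP => [/esym/xU //|_]; rewrite mem0v.
Qed.

Lemma indecomposable_gen : indecomposable comp ->
  <<[set gb i | i : I]>>%g = [set: Gam].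
Proof.
move=> indM; apply/eqP; rewrite finset.eqEsubset finset.subsetT -indM genS //.
apply/fintype.subsetP => g; rewrite inE => g0.
apply: contraR g0 => gI; rewrite -subv0; apply: subv_graded => j gj.
by rewrite -gj imset_f in gI.
Qed.

Hypotheses (actP : Defs.is_action act) (indM : indecomposable comp).
Hypothesis act_comp : forall g h, (act g @: comp h <= comp h)%VS.

(* The defining relation of [f] only constrains the action of the degrees
   [gb i], but both of its sides are multiplicative in the acting element. *)
Lemma twisted_commute form f : twisted_symmetry_wrt comp act x gb form f ->
  forall g h v, v \in comp h -> f (act g v) = form g h *: act g (f v).
Proof.
case=> [[form0 formM _] [fbij fgr _ _] fc] g h v.
pose K g h := lker (f \o act g - form g h *: (act g \o f))%VF.
have KE g' h' w : (w \in K g' h') = (f (act g' w) == form g' h' *: act g' (f w)).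
  by rewrite memv_ker !lfun_simp subr_eq0.
pose H := [set g | [forall h, comp h <= K g h]%VS].
have form1 h' : form 1%g h' = 1.
  by apply: (mulIf (form0 1%g h')); rewrite -formM mulg1 mul1r.
have gH : group_set H.
  apply/group_setP; split=> [|a b]; rewrite !inE.
    apply/forallP => k; apply/subvP => w _.
    by rewrite KE !(action1 actP) form1 scale1r.
  move=> /forallP Ha /forallP Hb; apply/forallP => k; apply/subvP => w wk.
  have /eqP wb : f (act b w) == form b k *: act b (f w).
    by rewrite -KE (subvP (Hb k)).
  have /eqP wa : f (act a (act b w)) == form a k *: act a (f (act b w)).
    by rewrite -KE (subvP (Ha k)) // (subvP (act_comp b k)) // memv_img.
  by rewrite KE !(actionM actP) wa wb linearZ /= scalerA formM.
have : g \in <<[set gb i | i : I]>>%g by rewrite indecomposable_gen // inE.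
have : <<[set gb i | i : I]>>%g \subset Group gH.
  rewrite gen_subG; apply/fintype.subsetP => _ /imsetP[i _ ->]; rewrite inE.
  apply/forallP => k; apply: subv_graded => j <-; rewrite KE; apply/eqP.
  have fxi0 : f (x i) != 0.
    apply: contra_neq (basis_vec_neq0 i) => fxi; apply: (bij_inj fbij).
    by rewrite fxi linear0.
  have xi := decomp_degree decM i.
  have fxi : f (x i) \in comp (gb i) by rewrite (subvP (fgr _)) // memv_img.
  apply: (tmul_injl fxi0); rewrite tmulZl.
  have := fc i j; rewrite /= (braidingE _ _ grd xi) !tmapE.
  by rewrite (braidingE _ _ grd fxi).
move=> /fintype.subsetP HS /HS; rewrite inE => /forallP/(_ h)/subvP cK vh.
by apply/eqP; rewrite -KE cK.
Qed.

End Braiding.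

Section Covering.
Variables (F : numClosedFieldType) (Gam Sig G : finGroupType).
Hypotheses (abGam : abelian [set: Gam]) (abSig : abelian [set: Sig]).
Variables (iota : {multiplicative dual Sig F -> G}).
Variables (pi : {morphism [set: G] >-> Gam}) (s : Gam -> G).
Hypotheses (ext : central_extension iota pi) (sec : normalized_section pi s).
Variable sig : Gam -> Gam -> dual Sig F.
Hypothesis sigE :
  forall g h, (s g * s h = iota (sig g h) * s (g * h))%g.

Lemma ext_piM g h : pi (g * h)%g = (pi g * pi h)%g.
Proof. by rewrite morphM ?inE. Qed.

Lemma ext_pi_iota lam : pi (iota lam) = 1%g.
Proof. by apply: mker; apply/(ext_exact ext); exists lam. Qed.

Lemma ext_pi_dec lam g : pi (iota lam * s g)%g = g.
Proof. by rewrite ext_piM ext_pi_iota mul1g (section_cancel sec). Qed.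

Lemma ext_iotaC lam g : commute (iota lam) g.
Proof.
have /centerP[_] := ext_central ext lam; apply; by rewrite inE.
Qed.

Lemma ker_dualK lam : ker_dual iota (iota lam) = lam.
Proof. by apply: xget_unique => // mu /(ext_inj ext). Qed.

Lemma mem_ext_ker h : (h * (s (pi h))^-1)%g \in ('ker pi)%g.
Proof.
apply/kerP; rewrite ?inE // ext_piM morphV ?inE //.
by rewrite (section_cancel sec) mulgV.
Qed.

Lemma ker_dualE h :
  iota (ker_dual iota (h * (s (pi h))^-1)%g) = (h * (s (pi h))^-1)%g.
Proof. by have [lam <-] := (ext_exact ext _).1 (mem_ext_ker h); rewrite ker_dualK. Qed.

Lemma ext_decomp h : h = (iota (ker_dual iota (h * (s (pi h))^-1)) * s (pi h))%g.
Proof. by rewrite ker_dualE mulgKV. Qed.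

Lemma conj_ext_decomp g lam k :
  (g * (iota lam * s k) * g^-1)%g =
    (iota (lam * (sig (pi g) k * (sig k (pi g))^-1)) * s k)%g.
Proof.
rewrite {1 2}(ext_decomp g); set mu := ker_dual _ _; set c := pi g.
have ck : (c * k = k * c)%g by apply: (centsP abGam); rewrite inE.
have sck : (s c * s k = iota (sig c k * (sig k c)^-1) * (s k * s c))%g.
  by rewrite !sigE ck mulgA -gmulfM -mulgA mulVg mulg1.
have iotaCA nu a b : (a * (iota nu * b) = iota nu * (a * b))%g.
  by rewrite !mulgA ext_iotaC.
apply: (canLR (mulgK _)).
by rewrite [RHS]iotaCA -[LHS]mulgA iotaCA sck gmulfM !mulgA.
Qed.

Variables (V : vectType F) (comp : Gam -> {vspace V}) (act : Gam -> 'End(V)).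
Variable f : Sig -> 'End(V).
Hypothesis fA : Defs.is_action f.

Definition eigen_proj (lam : dual Sig F) : 'End(V) :=
  \sum_p (lam p)^-1 *: f p.

Lemma eigen_projE lam mu v : v \in eigen f mu ->
  eigen_proj lam v = if mu == lam then #|Sig|%:R *: v else 0.
Proof.
move=> /eigenP vmu; rewrite sum_lfunE.
rewrite (eq_bigr (fun p => (mu * lam^-1)%g p *: v)); last first.
  by move=> p _; rewrite scale_lfunE vmu scalerA mulrC dualME dualVE.
rewrite -scaler_suml; case: eqVneq => [->|mulam].
  rewrite mulgV (eq_bigr (fun=> 1)) ?sumr_const // => p _; exact: dual1E.
rewrite sum_dual ?scale0r //; apply: contra_neq mulam => eq1.
by rewrite -[mu](mulgKV lam) eq1 mul1g.
Qed.

Local Notation covering := (covering_comp comp iota pi s f).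

Lemma covering_compE lam g : covering (iota lam * s g)%g = (eigen f lam :&: comp g)%VS.
Proof. by rewrite /covering_comp ext_pi_dec mulgK ker_dualK. Qed.

Hypothesis grd : is_grading comp.
Hypothesis f_comp : forall p g, (f p @: comp g <= comp g)%VS.

Lemma covering_grading : is_grading covering.
Proof.
split; last first.
  apply/eqP; rewrite eqEsubv subvf /= -[X in (X <= _)%VS]grd.2.
  apply/subv_sumP => g _; apply: (subv_eigen fA abSig) => // lam.
  by rewrite (sumv_sup (iota lam * s g)%g) // covering_compE.
apply/directv_sum_independent => us usP us0 k _.
pose lam h := ker_dual iota (h * (s (pi h))^-1)%g.
have Tus h : eigen_proj (lam k) (grade_proj comp (pi k) (us h)) =
    if h == k then #|Sig|%:R *: us k else 0.
  have /memv_capP[ulam upi] := usP h isT; rewrite (grade_projE _ grd upi).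
  case: eqP => [pikh|pikh]; last first.
    by rewrite linear0; case: eqP => // hk; case: pikh; rewrite hk.
  rewrite (eigen_projE _ ulam) -/(lam h); have [-> //|hk] := eqVneq h k.
    by rewrite eqxx.
  case: eqP => // lamE; case/eqP: hk.
  by rewrite (ext_decomp h) (ext_decomp k) -/(lam h) -/(lam k) lamE pikh.
have := congr1 (fun v => eigen_proj (lam k) (grade_proj comp (pi k) v)) us0.
rewrite /= !linear_sum !linear0 (eq_bigr _ (fun h _ => Tus h)) -big_mkcond.
rewrite big_pred1_eq => /eqP; rewrite scaler_eq0 => /orP[|/eqP //].
by rewrite pnatr_eq0 -cardsT (negPf (lt0n_neq0 (cardG_gt0 _))).
Qed.

Hypothesis ydM : is_yetter_drinfeld comp act.
Hypothesis f_act : forall p g h v, v \in comp h ->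
  f p (act g v) = sig_form sig p g h *: act g (f p v).

Lemma covering_act_sub g h :
  (act (pi g) @: covering h <= covering (g * h * g^-1)%g)%VS.
Proof.
have [lam [k ->]] : exists lam k, h = (iota lam * s k)%g.
  by exists (ker_dual iota (h * (s (pi h))^-1)%g), (pi h); apply: ext_decomp.
rewrite conj_ext_decomp !covering_compE; apply/subvP => w.
case/memv_imgP => v /memv_capP[/eigenP vlam vh] ->.
rewrite memv_cap; apply/andP; split.
  apply/eigenP => p; rewrite (f_act _ _ vh) vlam linearZ /= scalerA mulrC.
  by rewrite !ffunE.
have -> : k = (pi g * k * (pi g)^-1)%g.
  have -> : (pi g * k = k * pi g)%g by apply: (centsP abGam); rewrite inE.
  by rewrite mulgK.
by rewrite -(yd_compat ydM) memv_img.
Qed.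

Lemma covering_yetter_drinfeld :
  is_yetter_drinfeld covering (covering_act act pi).
Proof.
split; [split=> [|a b]|exact: covering_grading|move=> g h].
- by rewrite /covering_act morph1; case: (yd_action ydM).
- by rewrite /covering_act ext_piM; case: (yd_action ydM).
apply/eqP; rewrite eqEsubv covering_act_sub /=; apply/subvP => v vh.
have -> : v = act (pi g) (act (pi g^-1)%g v).
  by rewrite -(actionM (yd_action ydM)) -ext_piM mulgV morph1 (action1 (yd_action ydM)).
apply: memv_img; have := covering_act_sub g^-1%g (g * h * g^-1)%g.
by rewrite !mulgA mulVg mul1g invgK mulgKV => /subvP; apply; rewrite memv_img.
Qed.

Lemma eigenbasis : exists X : seq V, basis_of fullv X /\
  {in X, forall v, exists lam, v \in eigen f lam}.
Proof.
have [dir full] := covering_grading.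
exists (\big[cat/[::]]_h vbasis (covering h)); split.
  by rewrite -full; apply: bigcat_basis => // h _; apply: vbasisP.
move=> v; elim/big_ind: _ => // [X Y IX IY|h _ /vbasis_mem /memv_capP[vlam _]].
  by rewrite mem_cat => /orP[/IX|/IY].
by exists (ker_dual iota (h * (s (pi h))^-1)%g).
Qed.

Lemma covering_act_iota lam : covering_act act pi (iota lam) = \1%VF.
Proof. by rewrite /covering_act ext_pi_iota; case: (yd_action ydM). Qed.

Lemma covering_not_faithful : (1 < #|Sig|)%N ->
  ~ faithful_action (covering_act act pi).
Proof.
move=> /(nontrivial_dual F abSig)[lam lam1] faith; case/eqP: lam1.
apply: (ext_inj ext); rewrite (faith _ (covering_act_iota lam)).
by apply: (mulgI (iota 1%g)); rewrite -gmulfM !mulg1.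
Qed.

End Covering.

Theorem theorem3p6 (R : realType) (Gam Sig G : finGroupType)
  (abGam : abelian [set: Gam]) (abSig : abelian [set: Sig])
  (iota : {multiplicative dual Sig R[i] -> G})
  (pi : {morphism [set: G] >-> Gam})
  (ext : central_extension iota pi)
  (s : Gam -> G) (sec : normalized_section pi s)
  (sig : Gam -> Gam -> dual Sig R[i]) (sigZ2 : cocycle2 sig)
  (sigE : forall g h, (s g * s h = iota (sig g h) * s (g * h))%g)
  (M : vectType R[i]) (comp : Gam -> {vspace M}) (act : Gam -> 'End(M))
  (ydM : is_yetter_drinfeld comp act) (indM : indecomposable comp)
  (I : finType) (x : I -> M) (gb : I -> Gam) (chi : I -> dual Gam R[i])
  (decM : diagonal_decomposition comp act x gb chi)
  (f : Sig -> 'End(M))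
  (fP : acts_as_twisted_symmetries comp act x gb sig f) :
  [/\ exists X : seq M, basis_of fullv X /\
        {in X, forall v, exists lam, v \in eigen f lam},
      forall h, (h * (s (pi h))^-1)%g \in ('ker pi)%g /\
        iota (ker_dual iota (h * (s (pi h))^-1)%g) = (h * (s (pi h))^-1)%g,
      is_yetter_drinfeld (covering_comp comp iota pi s f) (covering_act act pi),
      forall lam, covering_act act pi (iota lam) = \1%VF &
      (1 < #|Sig|)%N -> ~ faithful_action (covering_act act pi)].
Proof.
have [fA fT] := fP; have [actA grd actC] := ydM.
have f_comp p g : (f p @: comp g <= comp g)%VS.
  by have [_ [_ fgr _ _] _] := fT p; apply: fgr.
have act_comp g h : (act g @: comp h <= comp h)%VS.
  rewrite actC; have -> : (g * h = h * g)%g by apply: (centsP abGam); rewrite inE.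
  by rewrite mulgK.
have f_act p g h v : v \in comp h ->
    f p (act g v) = sig_form sig p g h *: act g (f p v).
  by move=> vh; apply: (twisted_commute decM) (fT p) _ _ _ vh.
split.
- exact: (eigenbasis abSig ext sec fA grd f_comp).
- by move=> h; split; [apply: mem_ext_ker | apply: ker_dualE].
- exact: (covering_yetter_drinfeld abGam abSig ext sec sigE fA grd f_comp ydM f_act).
- exact: (covering_act_iota ext ydM).
exact: (covering_not_faithful abSig ext ydM).
Qed.
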